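(* Consider the approximate one-block (AOB) Metropolis--Hastings algorithm targeting the joint posterior density $\pi(\boldsymbol{x},\boldsymbol{\theta}\mid\boldsymbol{b})$, with proposal density $\hat\pi(\boldsymbol{x}'\mid\boldsymbol{\theta}',\boldsymbol{b})\,r(\boldsymbol{\theta}'\mid\boldsymbol{\theta})$. Let $(\boldsymbol{x},\boldsymbol{\theta})$ be the current state and $(\boldsymbol{x}',\boldsymbol{\theta}')$ the proposed state (so $r(\boldsymbol{\theta}'\mid\boldsymbol{\theta})>0$). Then the acceptance ratio $$\rho_2(\boldsymbol{x}',\boldsymbol{\theta}';\boldsymbol{x},\boldsymbol{\theta})=\min\left\{1,\frac{\pi(\boldsymbol{x}',\boldsymbol{\theta}'\mid\boldsymbol{b})\,\hat\pi(\boldsymbol{x}\mid\boldsymbol{\theta},\boldsymbol{b})\,r(\boldsymbol{\theta}\mid\boldsymbol{\theta}')}{\pi(\boldsymbol{x},\boldsymbol{\theta}\mid\boldsymbol{b})\,\hat\pi(\boldsymbol{x}'\mid\boldsymbol{\theta}',\boldsymbol{b})\,r(\boldsymbol{\theta}'\mid\boldsymbol{\theta})}\right\}$$ simplifies to $$\rho_2(\boldsymbol{x}',\boldsymbol{\theta}';\boldsymbol{x},\boldsymbol{\theta})=\min\left\{1,\frac{z(\boldsymbol{x}',\boldsymbol{\theta}')\,\pi(\boldsymbol{\theta}'\mid\boldsymbol{b})\,r(\boldsymbol{\theta}\mid\boldsymbol{\theta}')}{z(\boldsymbol{x},\boldsymbol{\theta})\,\pi(\boldsymbol{\theta}\mid\boldsymbol{b})\,r(\boldsymbol{\theta}'\mid\boldsymbol{\theta})}\right\},$$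 where $z(\boldsymbol{x},\boldsymbol{\theta})= w(\boldsymbol{x},\boldsymbol{\theta})/M_1(\boldsymbol{\theta})$.
   Context: Let $\boldsymbol{A}\in\mathbb{R}^{M\times N}$, $\boldsymbol{b}\in\mathbb{R}^M$, let $\boldsymbol{\Gamma}_{\rm prior}\in\mathbb{R}^{N\times N}$ be symmetric positive definite, and let $\boldsymbol{\theta}=(\mu,\sigma)\in(0,\infty)^2$. The hyperprior density is $\pi(\boldsymbol{\theta})\propto\mu^{\alpha_\mu-1}\sigma^{\alpha_\sigma-1}\exp(-\beta_\mu\mu-\beta_\sigma\sigma)$ with $\alpha_\mu,\alpha_\sigma,\beta_\mu,\beta_\sigma>0$ (independent Gamma distributions). The joint posterior density on $\mathbb{R}^N\times(0,\infty)^2$ is $$\pi(\boldsymbol{x},\boldsymbol{\theta}\mid\boldsymbol{b})\propto\mu^{M/2}\sigma^{N/2}\pi(\boldsymbol{\theta})\exp\left(-\tfrac{\mu}{2}\|\boldsymbol{A}\boldsymbol{x}-\boldsymbol{b}\|_2^2-\tfrac{\sigma}{2}\boldsymbol{x}^\top\boldsymbol{\Gamma}_{\rm prior}^{-1}\boldsymbol{x}\right),$$ and $\pi(\boldsymbol{\theta}\mid\boldsymbol{b})=\int_{\mathbb{R}^N}\pi(\boldsymbol{x},\boldsymbol{\theta}\mid\boldsymbol{b})\,d\boldsymbol{x}$ is its marginal density. Put $\boldsymbol{\Gamma}_{\rm cond}^{-1}(\boldsymbol{\theta})=\mu\boldsymbol{A}^\top\boldsymbol{A}+\sigma\boldsymbol{\Gamma}_{\rm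 prior}^{-1}$. For each $\boldsymbol{\theta}$ let $\widehat{\boldsymbol{\Gamma}}_{\rm cond}(\boldsymbol{\theta})$ be a symmetric positive definite $N\times N$ matrix (an approximation of $\boldsymbol{\Gamma}_{\rm cond}(\boldsymbol{\theta})$), put $\hat{\boldsymbol{x}}_{\rm cond}(\boldsymbol{\theta})=\mu\widehat{\boldsymbol{\Gamma}}_{\rm cond}(\boldsymbol{\theta})\boldsymbol{A}^\top\boldsymbol{b}$, and let $\hat\pi(\boldsymbol{x}\mid\boldsymbol{\theta},\boldsymbol{b})$ be the density of the Gaussian distribution $\mathcal{N}(\hat{\boldsymbol{x}}_{\rm cond}(\boldsymbol{\theta}),\widehat{\boldsymbol{\Gamma}}_{\rm cond}(\boldsymbol{\theta}))$. For each $\boldsymbol{\theta}$, $r(\cdot\mid\boldsymbol{\theta})$ is a proposal probability density on $(0,\infty)^2$. Define $$w(\boldsymbol{x},\boldsymbol{\theta})=\exp\left(-\tfrac12\boldsymbol{x}^\top\big(\boldsymbol{\Gamma}_{\rm cond}^{-1}(\boldsymbol{\theta})-\widehat{\boldsymbol{\Gamma}}_{\rm cond}^{-1}(\boldsymbol{\theta})\big)\boldsymbol{x}\right),$$ $$M_1(\boldsymbol{\theta})=\frac{\exp\left(\tfrac{\mu^2}{2}\boldsymbol{b}^\top\boldsymbol{A}\big(\boldsymbol{\Gamma}_{\rm cond}(\boldsymbol{\theta})-\widehat{\boldsymbol{\Gamma}}_{\rm cond}(\boldsymbol{\theta})\big)\boldsymbol{A}^\top\boldsymbol{b}\right)}{\left(\det\widehat{\boldsymbol{\Gamma}}_{\rm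 cond}(\boldsymbol{\theta})\cdot\det\boldsymbol{\Gamma}_{\rm cond}^{-1}(\boldsymbol{\theta})\right)^{1/2}}.$$ *)

(* Defs.v *)
From HB Require Import structures.
From mathcomp Require Import all_boot all_order all_algebra.
From mathcomp Require Import all_classical all_reals all_analysis.

Set Implicit Arguments.
Unset Strict Implicit.
Unset Printing Implicit Defensive.

Import Order.TTheory GRing.Theory Num.Theory.
Import numFieldNormedType.Exports.

Local Open Scope classical_set_scope.
Local Open Scope ring_scope.

Lemma sigma_finite_product d1 d2 (T1 : measurableType d1) (T2 : measurableType d2)
    (R : realType) (m1 : {sigma_finite_measure set T1 -> \bar R})
    (m2 : {sigma_finite_measure set T2 -> \bar R}) :
  sigma_finite setT (m1 \x m2)%E.
Proof.
have /sigma_finiteP[F [TF ndF Foo]] := sigma_finiteT m1.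
have /sigma_finiteP[G [TG ndG Goo]] := sigma_finiteT m2.
exists (fun k => F k `*` G k).
  apply/seteqP; split=> // -[x y] _.
  have [i _ Fi] : (\bigcup_i F i) x by rewrite -TF.
  have [j _ Gj] : (\bigcup_i G i) y by rewrite -TG.
  exists (maxn i j) => //; split => /=.
  - by move: x Fi; exact/subsetPset/ndF/leq_maxl.
  - by move: y Gj; exact/subsetPset/ndG/leq_maxr.
move=> k; have [mFk Fk] := Foo k; have [mGk Gk] := Goo k; split.
  exact: measurableX.
by rewrite product_measure1E// lte_mul_pinfty// ge0_fin_numE.
Qed.

(** * Lebesgue measure on R^N, carried by the measurable type of N-tuples *)

Definition tcons (T : Type) (n : nat) (p : T * n.-tuple T) : n.+1.-tuple T :=
  [tuple of p.1 :: p.2].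

Section tuple_pushforward.
Context (R : realType).
Local Notation Rm := (measurableTypeR R).

Lemma measurable_tcons (n : nat) :
  measurable_fun [set: Rm * n.-tuple Rm] (@tcons Rm n).
Proof. exact: measurable_cons. Qed.

Variables (n : nat) (m : {sigma_finite_measure set (n.-tuple Rm) -> \bar R}).

Definition tuple_prod : set (n.+1.-tuple Rm) -> \bar R :=
  pushforward (@lebesgue_measure R \x m)%E (@tcons Rm n).

Let tuple_prod0 : tuple_prod set0 = 0%E.
Proof. by rewrite /tuple_prod /pushforward preimage_set0 measure0. Qed.

Let tuple_prod_ge0 A : (0 <= tuple_prod A)%E.
Proof. by rewrite /tuple_prod /pushforward; apply: measure_ge0. Qed.

Let tuple_prod_sigma_additive : semi_sigma_additive tuple_prod.
Proof.
move=> F mF tF mUF; rewrite /tuple_prod /pushforward preimage_bigcup.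
apply: measure_semi_sigma_additive.
- by move=> k; rewrite -[X in measurable X]setTI; exact: measurable_tcons.
- apply/trivIsetP => /= i j _ _ ij; rewrite -preimage_setI.
  by move/trivIsetP : tF => /(_ _ _ _ _ ij) ->//; rewrite preimage_set0.
- by rewrite -preimage_bigcup -[X in measurable X]setTI; exact: measurable_tcons.
Qed.

HB.instance Definition _ := isMeasure.Build _ _ _ tuple_prod
  tuple_prod0 tuple_prod_ge0 tuple_prod_sigma_additive.

Let uncons (t : n.+1.-tuple Rm) : Rm * n.-tuple Rm :=
  (thead t, [tuple of behead t]).

Let measurable_uncons : measurable_fun setT uncons.
Proof.
apply/measurable_fun_pairP; split; last exact: measurable_behead.
exact: (@measurable_tnth _ Rm n.+1 ord0).
Qed.

Let tuple_prod_sigma_finite : sigma_finite setT tuple_prod.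
Proof.
have [F UF mF] := sigma_finite_product (@lebesgue_measure R) m.
exists (fun k => uncons @^-1` F k); first by rewrite -preimage_bigcup -UF.
move=> k; have [mFk Fk] := mF k; split.
  by rewrite -[X in measurable X]setTI; exact: measurable_uncons.
rewrite /tuple_prod /pushforward -comp_preimage.
rewrite (_ : uncons \o _ = id)//.
by apply/funext => -[a t] /=; rewrite /uncons theadE; congr pair; exact/val_inj.
Qed.

HB.instance Definition _ := Measure_isSigmaFinite.Build _ _ _ tuple_prod
  tuple_prod_sigma_finite.

End tuple_pushforward.

Fixpoint lebesgue_tuple (R : realType) (n : nat) :
    {sigma_finite_measure set (n.-tuple (measurableTypeR R)) -> \bar R} :=
  if n is k.+1 then tuple_prod (lebesgue_tuple R k) else \d_[tuple].

Lemma lebesgue_tuple_box (R : realType) (n : nat)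
    (B : 'I_n -> set (measurableTypeR R)) : (forall i, measurable (B i)) ->
  lebesgue_tuple R n [set t | forall i, B i (tnth t i)] =
  (\prod_(i < n) @lebesgue_measure R (B i))%E.
Proof.
have mbox k (C : 'I_k -> set (measurableTypeR R)) : (forall i, measurable (C i)) ->
    measurable [set t : k.-tuple _ | forall i, C i (tnth t i)].
  move=> mC; rewrite (_ : [set _ | _] = \bigcap_(i in [set: 'I_k])
      ((fun t : k.-tuple (measurableTypeR R) => tnth t i) @^-1` C i)); last first.
    by apply/seteqP; split=> t /= h i; [move=> _|]; exact: h.
  apply: fin_bigcap_measurable => // i _.
  by rewrite -[X in measurable X]setTI; exact: measurable_tnth.
elim: n B => [|n ih] B mB.
  by rewrite big_ord0 /= diracE mem_set//; case.
rewrite big_ord_recl /= /tuple_prod /pushforward.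
rewrite (_ : _ @^-1` _ =
    B ord0 `*` [set t | forall i, B (lift ord0 i) (tnth t i)]); last first.
  apply/seteqP; split=> -[a t] /=.
    by move=> h; split=> [|i]; [exact: (h ord0)|have := h (lift ord0 i); rewrite tnthS].
  by move=> [Ba Bt] i; case: (unliftP ord0 i) => [j|] ->; rewrite ?tnthS.
rewrite product_measure1E//; last exact: (mbox n (fun i => B (lift ord0 i))).
by congr (_ * _)%E; exact: (ih (fun i => B (lift ord0 i))).
Qed.

(** * Matrices, densities and Metropolis--Hastings acceptance *)

Definition spdmx (R : realType) (n : nat) (G : 'M[R]_n) : Prop :=
  G^T = G /\ forall x : 'cV[R]_n, x != 0 -> 0 < (x^T *m G *m x) 0 0.

(* The norm `|v| of the library is the sup norm on matrices. *)
Definition norm2 (R : realType) (n : nat) (v : 'cV[R]_n) : R :=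
  Num.sqrt (\sum_i v i 0 ^+ 2).

Definition is_density d (T : measurableType d) (R : realType)
    (mu : {measure set T -> \bar R}) (D : set T) (f : T -> R) : Prop :=
  [/\ measurable_fun D f, forall x, D x -> 0 <= f x
    & (\int[mu]_(x in D) (f x)%:E = 1)%E].

Definition gaussian_pdf (R : realType) (n : nat) (m : 'cV[R]_n) (G : 'M[R]_n)
    (x : 'cV[R]_n) : R :=
  (Num.sqrt (\det ((2 * pi) *: G)))^-1 *
  expR (- (1 / 2) * ((x - m)^T *m invmx G *m (x - m)) 0 0).

(* [q y x] is the density q(y | x) of proposing y from the current state x;
   likewise [r th' th] below is r(th' | th). *)
Definition mh_acceptance (R : realType) (S : Type) (target : S -> R)
    (q : S -> S -> R) (y x : S) : R :=
  Num.min 1 ((target y * q x y) / (target x * q y x)).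

(** * The hierarchical linear Gaussian model; theta = (mu, sigma) *)

Definition Theta (R : realType) : set (measurableTypeR R * measurableTypeR R) :=
  [set th | 0 < th.1 /\ 0 < th.2].
Arguments Theta : clear implicits.

Definition lebesgue2 (R : realType) :=
  (@lebesgue_measure R \x @lebesgue_measure R)%E.
Arguments lebesgue2 : clear implicits.

HB.instance Definition _ (R : realType) := Measure.on (lebesgue2 R).
HB.instance Definition _ (R : realType) := Measure_isSigmaFinite.Build _ _ _
  (lebesgue2 R) (sigma_finite_product lebesgue_measure lebesgue_measure).

(* Functions on 'cV[R]_n are integrated through this identification, since the
   measurable structure and the Lebesgue measure live on n-tuples. *)
Definition vec (R : realType) (n : nat) (t : n.-tuple (measurableTypeR R)) :
  'cV[R]_n := \col_i tnth t i.

Section model.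
Context (R : realType) (M N : nat).
Variables (A : 'M[R]_(M, N)) (b : 'cV[R]_M) (Gprior : 'M[R]_N).
Variables (amu asigma bmu bsigma : R).
Implicit Types (x : 'cV[R]_N) (th : R * R).

Definition hyperprior_kernel th : R :=
  th.1 `^ (amu - 1) * th.2 `^ (asigma - 1) *
  expR (- bmu * th.1 - bsigma * th.2).

Definition hyperprior th : R :=
  hyperprior_kernel th / \int[lebesgue2 R]_(t in Theta R) hyperprior_kernel t.

Definition posterior_kernel x th : R :=
  th.1 `^ (M%:R / 2) * th.2 `^ (N%:R / 2) * hyperprior th *
  expR (- (th.1 / 2) * norm2 (A *m x - b) ^+ 2
        - (th.2 / 2) * (x^T *m invmx Gprior *m x) 0 0).

Definition posterior x th : R :=
  posterior_kernel x th /
  \int[(lebesgue_tuple R N \x lebesgue2 R)%E]_(p in setT `*` Theta R)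
    posterior_kernel (vec p.1) p.2.

Definition marginal_posterior th : R :=
  \int[lebesgue_tuple R N]_t posterior (vec t) th.

Definition prec_cond th : 'M[R]_N :=
  th.1 *: (A^T *m A) + th.2 *: invmx Gprior.

Definition cov_cond th : 'M[R]_N := invmx (prec_cond th).

Variables (Ghat : R * R -> 'M[R]_N) (r : R * R -> R * R -> R).

Definition mean_hat th : 'cV[R]_N := th.1 *: (Ghat th *m A^T *m b).

Definition aob_proposal (s' s : 'cV[R]_N * (R * R)) : R :=
  gaussian_pdf (mean_hat s'.2) (Ghat s'.2) s'.1 * r s'.2 s.2.

Definition aob_acceptance (s' s : 'cV[R]_N * (R * R)) : R :=
  mh_acceptance (fun u => posterior u.1 u.2) aob_proposal s' s.

Definition aob_weight x th : R :=
  expR (- (1 / 2) * (x^T *m (prec_cond th - invmx (Ghat th)) *m x) 0 0).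

Definition aob_M1 th : R :=
  expR (th.1 ^+ 2 / 2 *
        (b^T *m A *m (cov_cond th - Ghat th) *m A^T *m b) 0 0) /
  Num.sqrt (\det (Ghat th) * \det (prec_cond th)).

Definition aob_z x th : R := aob_weight x th / aob_M1 th.

End model.

(* Main.v *)
(* The joint posterior factors exactly as
     pi(x, theta | b) = z(x, theta) pi(theta | b) hat-pi(x | theta, b),
   and the positive Gaussian densities hat-pi then cancel in the acceptance
   ratio.  The factorization amounts to completing the square in x and to the
   normalization of the Gaussian density of precision P, which is obtained by
   induction on the dimension: integrating out the first coordinate leaves a
   Gaussian whose precision is the Schur complement of the pivot P 0 0. *)
Require Import Defs.
From HB Require Import structures.
From mathcomp Require Import all_boot all_order all_algebra.
From mathcomp Require Import all_classical all_reals all_analysis.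
From mathcomp Require Import measurable_realfun ring lra.

Set Implicit Arguments.
Unset Strict Implicit.
Unset Printing Implicit Defensive.

Import Order.TTheory GRing.Theory Num.Theory.
Import numFieldNormedType.Exports.

Local Open Scope classical_set_scope.
Local Open Scope ring_scope.

(** * Quadratic forms and Schur complements *)

Definition qform (R : realType) n (P : 'M[R]_n) (x : 'cV[R]_n) : R :=
  (x^T *m P *m x) 0 0.

Lemma qformD (R : realType) n (P Q : 'M[R]_n) x :
  qform (P + Q) x = qform P x + qform Q x.
Proof. by rewrite /qform mulmxDr mulmxDl mxE. Qed.

Lemma qformZ (R : realType) n c (P : 'M[R]_n) x :
  qform (c *: P) x = c * qform P x.
Proof. by rewrite /qform -scalemxAr -scalemxAl mxE. Qed.

Lemma qformB (R : realType) n (P Q : 'M[R]_n) x :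
  qform (P - Q) x = qform P x - qform Q x.
Proof. by rewrite qformD -scaleN1r qformZ mulN1r. Qed.

Lemma qform0 (R : realType) n (P : 'M[R]_n) : qform P 0 = 0.
Proof. by rewrite /qform mulmx0 mxE. Qed.

(** Used to swap the two vectors of a scalar product, which is a 1 by 1 matrix. *)
Lemma trmx11 (R : Type) (A : 'M[R]_1) : A^T = A.
Proof. by apply/matrixP => i j; rewrite mxE !ord1. Qed.

Lemma qform_sub (R : realType) n (P : 'M[R]_n) x m : P^T = P ->
  qform P (x - m) = qform P x - 2 * (x^T *m (P *m m)) 0 0 + qform P m.
Proof.
move=> Psym; rewrite /qform [(x - m)^T]linearB/= !mulmxBl !mulmxBr.
have -> : m^T *m P *m x = x^T *m (P *m m).
  by rewrite -[LHS]trmx11 !trmx_mul Psym trmxK.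
by rewrite !mulmxA !mxE; ring.
Qed.

Lemma qform_block (R : realType) n (p a : R) (q u : 'cV[R]_n) (S : 'M[R]_n) :
  qform (block_mx p%:M q^T q S) (col_mx a%:M u) =
  p * a ^+ 2 + 2 * a * (q^T *m u) 0 0 + qform S u.
Proof.
have uq : u^T *m q = q^T *m u.
  by rewrite -[RHS]trmx11 trmx_mul trmxK.
rewrite /qform tr_col_mx mul_row_block mul_row_col tr_scalar_mx uq.
rewrite !mul_scalar_mx !mulmxDl !mul_mx_scalar -!scalemxAl.
by rewrite !mxE/= !mulr1n; ring.
Qed.

(** Elimination with the pivot [p = P 0 0]: the witness [q] is the rest of the first column divided
    by [p], and [S] is the Schur complement of [p]. *)
Lemma spdmx_schur (R : realType) n (P : 'M[R]_(1 + n)) : spdmx P ->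
  exists p (q : 'cV[R]_n) (S : 'M[R]_n),
    [/\ 0 < p, spdmx S, \det P = p * \det S &
        forall a u, qform P (col_mx a%:M u) =
                    p * (a + (q^T *m u) 0 0) ^+ 2 + qform S u].
Proof.
move=> [Psym Ppos]; set p := P 0 0; set q := dlsubmx P.
have PE : P = block_mx p%:M q^T q (drsubmx P).
  rewrite -{1}[P]submxK; congr (block_mx _ _ _ _).
    rewrite [LHS]mx11_scalar; congr (_%:M).
    by rewrite !mxE; congr (P _ _); exact: val_inj.
  by rewrite /q -[in RHS]Psym trmx_dlsub trmxK.
have p_gt0 : 0 < p.
  have e_neq0 : col_mx (1%:M : 'M[R]_1) (0 : 'cV[R]_n) != 0.
    by rewrite col_mx_eq0 negb_and oner_neq0.
  have := Ppos _ e_neq0; rewrite -/(qform _ _) PE qform_block qform0.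
  by rewrite mulmx0 mxE; nra.
have p0 : p != 0 by rewrite gt_eqF.
exists p, (p^-1 *: q), (drsubmx P - p^-1 *: (q *m q^T)).
have qq u : qform (q *m q^T) u = ((q^T *m u) 0 0) ^+ 2.
  rewrite /qform mulmxA -mulmxA (_ : u^T *m q = (q^T *m u)^T).
    by rewrite [q^T *m u]mx11_scalar tr_scalar_mx mul_scalar_mx !mxE/= !mulr1n.
  by rewrite trmx_mul trmxK.
(* Completing the square in the first coordinate. *)
have sq a u : qform P (col_mx a%:M u) =
    p * (a + ((p^-1 *: q)^T *m u) 0 0) ^+ 2 +
    qform (drsubmx P - p^-1 *: (q *m q^T)) u.
  rewrite {1}PE qform_block -scaleNr qformD qformZ qq linearZ/= -scalemxAl.
  by rewrite [X in a + X]mxE; field.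
split=> //.
- split.
    rewrite linearB/= linearZ/= trmx_mul trmxK.
    by rewrite trmx_drsub Psym.
  (* This [a] makes the square vanish, so the form of [S] at [u] is a value of the form of [P] at a
     nonzero vector. *)
  move=> u u0; pose a := - ((p^-1 *: q)^T *m u) 0 0.
  rewrite -/(qform _ _); have := sq a u.
  rewrite /a addNr expr0n/= mulr0 add0r => <-.
  by apply: Ppos; rewrite col_mx_eq0 negb_and u0 orbT.
(* Right multiplication by the unipotent [E] clears the upper right block of [P] and keeps the
   determinant. *)
- pose E : 'M[R]_(1 + n) := block_mx 1%:M (- (p^-1 *: q^T)) 0 1%:M.
  have detE : \det E = 1 by rewrite det_ublock !det1 mulr1.
  have PEE : P *m E = block_mx p%:M 0 q (drsubmx P - p^-1 *: (q *m q^T)).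
    rewrite {1}PE mulmx_block !mulmx1 !mulmx0 !addr0 mul_scalar_mx.
    rewrite scalerN scalerA divff// scale1r addNr mulmxN -scalemxAr.
    by rewrite addrC.
  by rewrite -[LHS]mulr1 -detE -det_mulmx PEE det_lblock det_scalar1.
Qed.

Lemma spdmx_det_gt0 (R : realType) n (P : 'M[R]_n) : spdmx P -> 0 < \det P.
Proof.
elim: n P => [|n ih] P Ppd; first by rewrite det_mx00.
have [p [q [S [p_gt0 Spd -> _]]]] := spdmx_schur Ppd.
by rewrite mulr_gt0// ih.
Qed.

(** * Gaussian integrals *)

(** The integrand is [Num.sqrt (2 * pi / p)] times the normal density of mean [- c] and variance
    [1 / p]. *)
Lemma integral_gauss1 (R : realType) (p c : R) : 0 < p ->
  (\int[@lebesgue_measure R]_a (expR (- (1 / 2) * (p * (a + c) ^+ 2)))%:E =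
   (Num.sqrt (2 * pi / p))%:E)%E.
Proof.
move=> p_gt0; have p0 : p != 0 by rewrite gt_eqF.
pose s := (Num.sqrt p)^-1.
have s2 : s ^+ 2 = p^-1 by rewrite exprVn sqr_sqrtr// ltW.
have s0 : s != 0 by rewrite invr_eq0 sqrtr_eq0 -ltNge.
transitivity (\int[@lebesgue_measure R]_a
    ((Num.sqrt (2 * pi / p))%:E * (normal_pdf (- c) s a)%:E))%E.
  apply: eq_integral => a _; rewrite normal_pdfE// /normal_peak /normal_fun s2.
  rewrite -EFinM [X in _ = X%:E]mulrA (_ : p^-1 * pi *+ 2 = 2 * pi / p);
    last by field.
  rewrite divff; last first.
    by rewrite gt_eqF// sqrtr_gt0 divr_gt0// mulr_gt0// pi_gt0.
  by rewrite [X in _ = X%:E]mul1r opprK; congr (expR _)%:E; field.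
rewrite ge0_integralZl_EFin//.
- by rewrite integral_normal_pdf mule1.
- by move=> a _; rewrite lee_fin normal_pdf_ge0.
- by apply/measurable_EFinP; exact: measurable_normal_pdf.
Qed.

Lemma measurable_qform_vec (R : realType) n (P : 'M[R]_n) (m : 'cV[R]_n) :
  measurable_fun [set: n.-tuple (measurableTypeR R)]
    (fun t => qform P (vec t - m)).
Proof.
(* Written out, the form is a polynomial in the coordinates, which are measurable. *)
rewrite /qform; apply: (eq_measurable_fun (fun t : n.-tuple (measurableTypeR R) =>
  \sum_j (\sum_i (tnth t i - m i 0) * P i j) * (tnth t j - m j 0))).
  move=> t _; rewrite mxE; apply: eq_bigr => j _; rewrite !mxE; congr (_ * _).
  by apply: eq_bigr => i _; rewrite !mxE.
have mB i : measurable_fun [set: n.-tuple (measurableTypeR R)]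
    (fun t => tnth t i - m i 0 : R).
  by apply: measurable_funB => //; exact: measurable_tnth.
apply: measurable_sum => j; apply: measurable_funM => //.
by apply: measurable_sum => i; apply: measurable_funM.
Qed.

Lemma measurable_gauss (R : realType) n (P : 'M[R]_n) (m : 'cV[R]_n) :
  measurable_fun [set: n.-tuple (measurableTypeR R)]
    (fun t => (expR (- (1 / 2) * qform P (vec t - m)))%:E).
Proof.
apply/measurable_EFinP; apply: measurableT_comp => //.
by apply: measurable_funM => //; exact: measurable_qform_vec.
Qed.

(** The centre [m] stays arbitrary: the induction hypothesis takes its tail, and [integral_gauss1]
    absorbs its first entry in the offset [c]. *)
Lemma integral_gauss (R : realType) n (P : 'M[R]_n) (m : 'cV[R]_n) : spdmx P ->
  (\int[lebesgue_tuple R n]_t (expR (- (1 / 2) * qform P (vec t - m)))%:E =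
   (Num.sqrt ((2 * pi) ^+ n / \det P))%:E)%E.
Proof.
elim: n P m => [|n ih] P m Ppd.
  (* In dimension 0 the measure is the Dirac mass at the empty tuple and the determinant is 1. *)
  rewrite /= integral_dirac//; last exact: measurable_gauss.
  rewrite diracT mul1e det_mx00 expr0 divr1 sqrtr1.
  rewrite (flatmx0 (_ - m)) qform0.
  by rewrite mulr0 expR0.
have [p [q [S [p_gt0 Spd detP sqP]]]] := spdmx_schur Ppd.
rewrite /= ge0_integral_pushforward//=;
  [|exact: measurable_tcons|exact: measurable_gauss].
rewrite preimage_setT fubini_tonelli2//=; first last.
  by apply: measurableT_comp (measurable_gauss P m) _; exact: measurable_tcons.
pose m0 := m 0 0; pose m1 : 'cV_n := dsubmx (m : 'cV_(1 + n)).
have vecE (a : R) (t : n.-tuple R) :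
    vec (tcons (a, t)) - m = col_mx (a - m0)%:M (vec t - m1) :> 'cV_(1 + n).
  apply/matrixP => i j; rewrite ord1 !mxE; case: splitP => k ik.
    rewrite (_ : i = ord0) ?tnth0 ?mxE ?ord1 ?eqxx ?mulr1n//.
    by apply: val_inj; rewrite /= ik ord1.
  rewrite (_ : i = lift ord0 k) ?tnthS ?mxE; last exact: val_inj.
  by congr (_ - m _ _); exact: val_inj.
transitivity (\int[lebesgue_tuple R n]_t ((Num.sqrt (2 * pi / p))%:E *
    (expR (- (1 / 2) * qform S (vec t - m1)))%:E))%E.
  apply: eq_integral => t _; rewrite /fubini_G.
  (* With the tail [t] fixed, the factor in [S] is constant in [a] and the other one is a
     one-dimensional Gaussian of precision [p]. *)
  under eq_integral do rewrite vecE sqP mulrDr expRD -addrA EFinM muleC.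
  rewrite ge0_integralZl_EFin ?expR_ge0//.
  - by rewrite integral_gauss1// muleC.
  - apply/measurable_EFinP; apply: measurableT_comp => //.
    apply: measurable_funM => //; apply: measurable_funM => //.
    exact: measurable_funX (measurable_funD _ _).
rewrite ge0_integralZl_EFin//; last exact: measurable_gauss.
rewrite ih// -EFinM -sqrtrM; last by rewrite divr_ge0 ?mulr_ge0 ?pi_ge0// ltW.
by rewrite detP exprS invfM mulrACA.
Qed.

(** * Inverses, normalizing constants and completing the square *)

Lemma spdmx_unit (R : realType) n (P : 'M[R]_n) : spdmx P -> P \in unitmx.
Proof. by move=> /spdmx_det_gt0 h; rewrite unitmxE unitfE gt_eqF. Qed.

(** The form of [invmx P] at [x] is the form of [P] at [invmx P *m x]. *)
Lemma spdmx_inv (R : realType) n (P : 'M[R]_n) : spdmx P -> spdmx (invmx P).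
Proof.
move=> Ppd; have Pu := spdmx_unit Ppd; have [Psym Ppos] := Ppd.
have Isym : (invmx P)^T = invmx P by rewrite trmx_inv Psym.
split=> // x x0.
have -> : x^T *m invmx P *m x = (invmx P *m x)^T *m P *m (invmx P *m x).
  by rewrite trmx_mul Isym -!mulmxA [P *m _]mulmxA mulmxV// mul1mx.
apply: Ppos; apply: contra x0 => /eqP h.
by rewrite -[x](mulKVmx Pu) h mulmx0.
Qed.

Lemma norm2_sqr (R : realType) n (v : 'cV[R]_n) : norm2 v ^+ 2 = (v^T *m v) 0 0.
Proof.
rewrite sqr_sqrtr ?sumr_ge0// => [|i _]; last exact: sqr_ge0.
by rewrite mxE; apply: eq_bigr => i _; rewrite mxE expr2.
Qed.

Lemma det_scale_sqrt (R : realType) n (G : 'M[R]_n) :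
  Num.sqrt (\det ((2 * pi) *: G)) = Num.sqrt ((2 * pi) ^+ n) * Num.sqrt (\det G).
Proof. by rewrite detZ sqrtrM// exprn_ge0// mulr_ge0// pi_ge0. Qed.

Lemma gaussian_pdf_gt0 (R : realType) n (m : 'cV[R]_n) (G : 'M[R]_n) x :
  spdmx G -> 0 < gaussian_pdf m G x.
Proof.
move=> Gpd; rewrite mulr_gt0 ?expR_gt0// invr_gt0 sqrtr_gt0 detZ.
by rewrite mulr_gt0 ?spdmx_det_gt0// exprn_gt0// mulr_gt0// pi_gt0.
Qed.

(** Completing the square in [x]. Applied below with [c] equal to [A^T *m b], both to the exact
    conditional precision and to the inverse of [Ghat th]. *)
Lemma qform_center (R : realType) n (P : 'M[R]_n) x c (mu : R) : spdmx P ->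
  - (1 / 2) * qform P x + mu * (x^T *m c) 0 0 =
  - (1 / 2) * qform P (x - mu *: (invmx P *m c)) +
  mu ^+ 2 / 2 * qform (invmx P) c.
Proof.
move=> Ppd; have Pu := spdmx_unit Ppd; have [Psym _] := Ppd.
rewrite qform_sub// -!scalemxAr mulKVmx//.
have -> : qform P (mu *: (invmx P *m c)) = mu ^+ 2 * qform (invmx P) c.
  rewrite /qform [_^T]linearZ/= trmx_mul trmx_inv Psym -!scalemxAl -scalemxAr.
  by rewrite -[_ *m P *m _]mulmxA mulKVmx// !scalerA -expr2 mxE.
by rewrite [(mu *: (_ *m _)) 0 0]mxE; field.
Qed.

(** * Factorization of the joint posterior *)

Section model_identity.
Context (R : realType) (M N : nat).
Variables (A : 'M[R]_(M, N)) (b : 'cV[R]_M) (Gprior : 'M[R]_N).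
Variables (amu asigma bmu bsigma : R) (Ghat : R * R -> 'M[R]_N).

(** The data term is a squared norm, hence nonnegative; strictness comes from the prior term. *)
Lemma prec_cond_spd th : spdmx Gprior -> Theta R th ->
  spdmx (prec_cond A Gprior th).
Proof.
move=> Gpd [mu_gt0 sigma_gt0]; have [Isym Ipos] := spdmx_inv Gpd; split.
  by rewrite linearD/= !linearZ/= trmx_mul trmxK Isym.
move=> x x0; rewrite -/(qform _ _) qformD !qformZ.
have AA : 0 <= qform (A^T *m A) x.
  by rewrite /qform mulmxA -mulmxA -trmx_mul -norm2_sqr sqr_ge0.
by rewrite ltr_wpDl ?mulr_gt0 ?Ipos// mulr_ge0// ltW.
Qed.

(* The normalizing constants of [hyperprior] and [posterior] are kept abstract:
   the factorization below is linear in [posterior_const], so it holds even if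
   they were the junk values [0]. *)
Definition posterior_const th : R :=
  th.1 `^ (M%:R / 2) * th.2 `^ (N%:R / 2) * hyperprior amu asigma bmu bsigma th *
  expR (- (th.1 / 2) * (b^T *m b) 0 0) /
  \int[(lebesgue_tuple R N \x lebesgue2 R)%E]_(p in setT `*` Theta R)
    posterior_kernel A b Gprior amu asigma bmu bsigma (vec p.1) p.2.

Let g := A^T *m b.

(** Expanding the misfit sends its [b^T *m b] term to the constant and leaves an unnormalized
    Gaussian in [x]. *)
Lemma posteriorE x th :
  posterior A b Gprior amu asigma bmu bsigma x th =
  posterior_const th *
  expR (- (1 / 2) * qform (prec_cond A Gprior th) x + th.1 * (x^T *m g) 0 0).
Proof.
rewrite /posterior /posterior_const [RHS]mulrAC; congr (_ / _).
rewrite /posterior_kernel -[RHS]mulrA; congr (_ * _); rewrite -expRD; congr expR.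
rewrite norm2_sqr qformD !qformZ -/(qform _ _).
have -> : (A *m x - b)^T *m (A *m x - b) =
    x^T *m (A^T *m A) *m x - x^T *m g - x^T *m g + b^T *m b.
  rewrite [(_ - _)^T]linearB/= trmx_mul mulmxBl !mulmxBr.
  rewrite (_ : b^T *m (A *m x) = x^T *m g); last first.
    by rewrite -[LHS]trmx11 !trmx_mul trmxK mulmxA.
  by rewrite /g !mulmxA opprD opprK addrA.
rewrite /qform; move: (x^T *m (A^T *m A) *m x) (x^T *m g) (b^T *m b) => u v w.
by rewrite !mxE; field.
Qed.

Lemma marginal_posteriorE th : spdmx Gprior -> Theta R th ->
  marginal_posterior A b Gprior amu asigma bmu bsigma th =
  posterior_const th *
  expR (th.1 ^+ 2 / 2 * qform (cov_cond A Gprior th) g) *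
  (Num.sqrt ((2 * pi) ^+ N) / Num.sqrt (\det (prec_cond A Gprior th))).
Proof.
move=> Gpd thP; have Ppd := prec_cond_spd Gpd thP.
rewrite /marginal_posterior.
under eq_Rintegral do rewrite posteriorE qform_center// addrC expRD mulrA.
have I := integral_gauss (th.1 *: (invmx (prec_cond A Gprior th) *m g)) Ppd.
(* Pulling constants out of the real-valued integral requires integrability, given by the finite
   value in [I]. *)
rewrite RintegralZl//; last first.
  apply/integrableP; split; first exact: measurable_gauss.
  under eq_integral do rewrite gee0_abs ?lee_fin ?expR_ge0//.
  by rewrite I ltry.
rewrite /Rintegral I/= sqrtrM ?exprn_ge0 ?mulr_ge0 ?pi_ge0//.
by rewrite sqrtrV// ltW// spdmx_det_gt0.
Qed.

(** The exact and approximate conditionals share the linear term in [x]. Their quadratic terms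
    differ by the exponent of [aob_weight], and [aob_M1] is the ratio of their normalizations. *)
Lemma posterior_factor x th : spdmx Gprior -> Theta R th -> spdmx (Ghat th) ->
  posterior A b Gprior amu asigma bmu bsigma x th =
  aob_z A b Gprior Ghat x th *
  marginal_posterior A b Gprior amu asigma bmu bsigma th *
  gaussian_pdf (mean_hat A b Ghat th) (Ghat th) x.
Proof.
move=> Gpd thP Hpd; have Ppd := prec_cond_spd Gpd thP.
rewrite marginal_posteriorE// posteriorE /aob_z /aob_weight /aob_M1 /gaussian_pdf.
rewrite det_scale_sqrt sqrtrM ?ltW ?spdmx_det_gt0// -!/(qform _ _).
(* The double inverse shows [mean_hat] as the centre that [qform_center] yields for the precision
   [invmx (Ghat th)]. *)
have -> : mean_hat A b Ghat th = th.1 *: (invmx (invmx (Ghat th)) *m g).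
  by rewrite invmxK /mean_hat mulmxA.
have := qform_center x g th.1 (spdmx_inv Hpd); rewrite invmxK => E.
have Eb : b^T *m A *m (cov_cond A Gprior th - Ghat th) *m A^T *m b =
    g^T *m (cov_cond A Gprior th - Ghat th) *m g.
  by rewrite trmx_mul trmxK !mulmxA.
rewrite Eb -!/(qform _ _) !qformB.
set P := qform (prec_cond A Gprior th) x; set Q := qform (invmx (Ghat th)) x in E *.
set l := th.1 * (x^T *m g) 0 0 in E *.
(* The weight exponent splits off; [E] completes the square in what remains. *)
have -> : - (1 / 2) * P + l = - (1 / 2) * (P - Q) + (- (1 / 2) * Q + l) by field.
rewrite E 2!expRD (mulrBr _ (qform _ g)) expRD expRN.
have sP : Num.sqrt (\det (prec_cond A Gprior th)) != 0.
  by rewrite gt_eqF// sqrtr_gt0 spdmx_det_gt0.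
have sH : Num.sqrt (\det (Ghat th)) != 0.
  by rewrite gt_eqF// sqrtr_gt0 spdmx_det_gt0.
have s2 : Num.sqrt ((2 * pi) ^+ N : R) != 0.
  by rewrite gt_eqF// sqrtr_gt0 exprn_gt0// mulr_gt0// pi_gt0.
by field; rewrite sP sH s2 !gt_eqF ?expR_gt0.
Qed.

End model_identity.

(** * Cancellation in the acceptance ratio *)

Theorem proposition1 (R : realType) (M N : nat)
    (A : 'M[R]_(M, N)) (b : 'cV[R]_M) (Gprior : 'M[R]_N)
    (amu asigma bmu bsigma : R)
    (Ghat : R * R -> 'M[R]_N) (r : R * R -> R * R -> R)
    (hGprior : spdmx Gprior)
    (hamu : 0 < amu) (hasigma : 0 < asigma)
    (hbmu : 0 < bmu) (hbsigma : 0 < bsigma)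
    (hGhat : forall th, Theta R th -> spdmx (Ghat th))
    (hr : forall th, Theta R th -> is_density (lebesgue2 R) (Theta R) (r ^~ th))
    (x x' : 'cV[R]_N) (th th' : R * R)
    (hth : Theta R th) (hth' : Theta R th') (hrpos : 0 < r th' th) :
  aob_acceptance A b Gprior amu asigma bmu bsigma Ghat r (x', th') (x, th) =
  Num.min 1
    ((aob_z A b Gprior Ghat x' th' *
      marginal_posterior A b Gprior amu asigma bmu bsigma th' * r th th') /
     (aob_z A b Gprior Ghat x th *
      marginal_posterior A b Gprior amu asigma bmu bsigma th * r th' th)).
Proof.
rewrite /aob_acceptance /mh_acceptance /aob_proposal /=.
rewrite !(posterior_factor (Ghat := Ghat) A b amu asigma bmu bsigma)//;
  try exact: hGhat.
have := gaussian_pdf_gt0 (mean_hat A b Ghat th) x (hGhat _ hth).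
have := gaussian_pdf_gt0 (mean_hat A b Ghat th') x' (hGhat _ hth').
move: (gaussian_pdf _ _ x) (gaussian_pdf _ _ x') => G G' G'0 G0.
congr (Num.min 1 _).
(* Numerator and denominator each contain both [G] and [G'], one from the factored target and one
   from the proposal. *)
rewrite (mulrC G) (mulrC G') mulrACA [X in _ / X]mulrACA -mulf_div (mulrC G').
by rewrite divff ?mulr1// gt_eqF// mulr_gt0.
Qed.
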